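(* Let $D,G\in\mathsf{Form}_{\mathsf{MA}^\omega}$ and let $x$ be an object variable such that $\mathsf{MA}^\omega\vdash D^{\mathbf F}\to D$ and $\mathsf{MA}^\omega\vdash\forall_x\bigl(G\to(G^{\mathbf F}\to\bot)\to\bot\bigr)$. Assume moreover that $\mathsf{MA}^\omega\vdash D\to\forall_x(G\to\bot)\to\bot$. Then $\mathsf{HA}^\omega\vdash D^{\mathbf F}\to\exists_xG^{\mathbf F}$.
   Context: **Types.** Generated from countably many type variables $\xi$ by $\tau,\rho::=\xi\mid\mathbb B\mid\mathbb N\mid\mathbb L(\tau)\mid\tau\to\rho\mid\tau\times\rho$ (booleans, natural numbers, lists, functions, pairs). **Terms.** Simply typed terms built by application and $\lambda$-abstraction from typed object variables (countably many for each type), the constructors $\langle\cdot,\cdot\rangle:\tau\to\rho\to\tau\times\rho$; $\mathsf{tt},\mathsf{ff}:\mathbb B$; $0:\mathbb N$; $\mathsf S:\mathbb N\to\mathbb N$; $\mathsf{nil}_\tau:\mathbb L(\tau)$; $\cdot::_\tau\cdot:\tau\to\mathbb L(\tau)\to\mathbb L(\tau)$, and the destructors $\mathsf{split}:\rho\times\sigma\to(\rho\to\sigma\to\tau)\to\tau$; $\mathsf{Cases}:\mathbb B\to\tau\to\tau\to\tau$; $\mathcal R_{\mathbb N}:\mathbb N\to\tau\to(\mathbb N\to\tau\to\tau)\to\tau$; $\mathcal R_{\mathbb L(\rho)}:\mathbb L(\rho)\to\tau\to(\rho\to\mathbb L(\rho)\to\tau\to\tau)\to\tau$ (for all types $\rho,\sigma,\tau$).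 The usual conversion rules hold: $(\lambda_x t(x))s\mapsto t(s)$, $\mathsf{split}\langle t,s\rangle f\mapsto f\,t\,s$, $\mathsf{Cases}\,\mathsf{tt}\,t\,s\mapsto t$, $\mathsf{Cases}\,\mathsf{ff}\,t\,s\mapsto s$, $\mathcal R_{\mathbb N}\,0\,a\,f\mapsto a$, $\mathcal R_{\mathbb N}(\mathsf Sn)\,a\,f\mapsto f\,n(\mathcal R_{\mathbb N}\,n\,a\,f)$, $\mathcal R_{\mathbb L(\rho)}\,\mathsf{nil}\,a\,f\mapsto a$, $\mathcal R_{\mathbb L(\rho)}(x::l)\,a\,f\mapsto f\,x\,l(\mathcal R_{\mathbb L(\rho)}\,l\,a\,f)$; a proof of a formula also counts as a proof of any formula obtained from it by converting terms inside it. Bound variables may be renamed, and substitution is capture-avoiding. **Formulas.** Formulas of $\mathsf{MA}^\omega$: atomic formulas $\mathsf{at}(t)$ for terms $t:\mathbb B$ and the symbol $\bot$, closed under $A\to B$, $A\wedge B$, $\forall_xA$ ($x$ an object variable of any type). Formulas of $\mathsf{HA}^\omega$: atomic formulas $\mathsf{at}(t)$ (no $\bot$), closed under $\to,\wedge,\vee,\forall_x,\exists_x$. $\mathsf{Form}_{\mathsf{XA}^\omega}$ is the set of formulas of $\mathsf{XA}^\omega$. Abbreviations: $\mathbf T:=\mathsf{at}(\mathsf{tt})$, $\mathbf F:=\mathsf{at}(\mathsf{ff})$, $\neg A:=A\to\mathbf F$. Implication associates to the right. **Substitution for $\bot$.** $A^S$ is the result of replacing $\bot$ by the formula $S$ in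 $A$: $\bot^S:=S$, $\mathsf{at}(t)^S:=\mathsf{at}(t)$, $(A\circ B)^S:=A^S\circ B^S$ for $\circ\in\{\wedge,\to\}$, $(\forall_xA)^S:=\forall_xA^S$ (renaming $x$ if necessary to avoid capture). **Proofs.** Natural deduction with assumption variables: introduction and elimination rules for $\to$, $\wedge$, $\forall$ (for $\forall$-introduction, $x$ must not be free in any open assumption). Common axioms (for all formulas $A$ of the system): $\mathbf T$; $\forall_b(A(\mathsf{tt})\to A(\mathsf{ff})\to A(b))$ with $b:\mathbb B$; $\forall_n(A(0)\to\forall_n(A(n)\to A(\mathsf Sn))\to A(n))$; $\forall_l(A(\mathsf{nil})\to\forall_{x,l}(A(l)\to A(x::l))\to A(l))$. $\mathsf{MA}^\omega$ has in addition the axiom $\bot^+:\mathbf F\to\bot$. $\mathsf{HA}^\omega$ has in addition to the common axioms: $A\to A\vee B$; $B\to A\vee B$; $A\vee B\to(A\to C)\to(B\to C)\to C$; $A(t)\to\exists_xA(x)$; $\exists_xA\to\forall_x(A\to C)\to C$ ($x$ not free in $C$). $\mathsf{XA}^\omega\vdash A$ means that there is a proof of $A$ in $\mathsf{XA}^\omega$ without free assumptions. *)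

(* Defs.v *)
From Stdlib Require Import List.
Import ListNotations.

(** * Types *)

Inductive ty : Type :=
| TVar (i : nat)
| Bool
| Nat
| List (tau : ty)
| Arr (tau rho : ty)
| Prod (tau rho : ty).

Definition ty_eq_dec (tau rho : ty) : {tau = rho} + {tau <> rho}.
Proof. repeat decide equality. Defined.

Infix "~>" := Arr (at level 55, right associativity).

(** * Terms *)

Inductive const : ty -> Type :=
| CPair (tau rho : ty) : const (tau ~> rho ~> Prod tau rho)
| CTT : const Bool
| CFF : const Bool
| CZero : const Nat
| CSucc : const (Nat ~> Nat)
| CNil (tau : ty) : const (List tau)
| CCons (tau : ty) : const (tau ~> List tau ~> List tau)
| CSplit (rho sigma tau : ty) :
    const (Prod rho sigma ~> (rho ~> sigma ~> tau) ~> tau)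
| CCases (tau : ty) : const (Bool ~> tau ~> tau ~> tau)
| CRecN (tau : ty) : const (Nat ~> tau ~> (Nat ~> tau ~> tau) ~> tau)
| CRecL (rho tau : ty) :
    const (List rho ~> tau ~> (rho ~> List rho ~> tau ~> tau) ~> tau).

(** Terms are intrinsically typed and taken up to alpha-equivalence.  There is
    one sequence of de Bruijn indices for each type: a binder of type [rho]
    binds [Var rho 0] and increments the indices of the other variables of type
    [rho], leaving variables of all other types untouched.  The indices pointing
    past the enclosing binders are the free object variables, so there are
    countably many of them for each type. *)
Inductive tm : ty -> Type :=
| Var (tau : ty) (n : nat) : tm tau
| Cst {tau : ty} (c : const tau) : tm tau
| App {rho tau : ty} (t : tm (rho ~> tau)) (s : tm rho) : tm tau
| Lam (rho : ty) {tau : ty} (t : tm tau) : tm (rho ~> tau).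

Definition ren := ty -> nat -> nat.

Definition shift (rho : ty) : ren :=
  fun tau n => if ty_eq_dec rho tau then S n else n.

Definition up_ren (rho : ty) (r : ren) : ren :=
  fun tau n =>
    if ty_eq_dec rho tau
    then match n with 0 => 0 | S m => S (r tau m) end
    else r tau n.

Fixpoint ren_tm (r : ren) {tau : ty} (t : tm tau) : tm tau :=
  match t with
  | Var tau n => Var tau (r tau n)
  | Cst c => Cst c
  | App t s => App (ren_tm r t) (ren_tm r s)
  | Lam rho t => Lam rho (ren_tm (up_ren rho r) t)
  end.

Definition sub := forall tau : ty, nat -> tm tau.

Definition scons {rho : ty} (t : tm rho) (s : sub) : sub :=
  fun tau n =>
    match ty_eq_dec rho tau with
    | left e => match n with 0 => eq_rect rho tm t tau e | S m => s tau m end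
    | right _ => s tau n
    end.

Definition up (rho : ty) (s : sub) : sub :=
  scons (Var rho 0) (fun tau n => ren_tm (shift rho) (s tau n)).

Fixpoint sub_tm (s : sub) {tau : ty} (t : tm tau) : tm tau :=
  match t with
  | Var tau n => s tau n
  | Cst c => Cst c
  | App t u => App (sub_tm s t) (sub_tm s u)
  | Lam rho t => Lam rho (sub_tm (up rho s) t)
  end.

Definition inst_tm {rho tau : ty} (t : tm tau) (u : tm rho) : tm tau :=
  sub_tm (scons u Var) t.

Definition tt_ : tm Bool := Cst CTT.
Definition ff_ : tm Bool := Cst CFF.
Definition zero : tm Nat := Cst CZero.
Definition succ (n : tm Nat) : tm Nat := App (Cst CSucc) n.
Definition nil_ (tau : ty) : tm (List tau) := Cst (CNil tau).
Definition cons_ {tau : ty} (x : tm tau) (l : tm (List tau)) : tm (List tau) :=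
  App (App (Cst (CCons tau)) x) l.
Definition pair_ {tau rho : ty} (t : tm tau) (s : tm rho) : tm (Prod tau rho) :=
  App (App (Cst (CPair tau rho)) t) s.
Definition split_ {rho sigma tau : ty}
    (p : tm (Prod rho sigma)) (f : tm (rho ~> sigma ~> tau)) : tm tau :=
  App (App (Cst (CSplit rho sigma tau)) p) f.
Definition cases_ {tau : ty} (b : tm Bool) (t s : tm tau) : tm tau :=
  App (App (App (Cst (CCases tau)) b) t) s.
Definition recN {tau : ty}
    (n : tm Nat) (a : tm tau) (f : tm (Nat ~> tau ~> tau)) : tm tau :=
  App (App (App (Cst (CRecN tau)) n) a) f.
Definition recL {rho tau : ty} (l : tm (List rho)) (a : tm tau)
    (f : tm (rho ~> List rho ~> tau ~> tau)) : tm tau :=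
  App (App (App (Cst (CRecL rho tau)) l) a) f.

Inductive conv : forall tau : ty, tm tau -> tm tau -> Prop :=
| conv_refl tau (t : tm tau) : conv tau t t
| conv_sym tau (t s : tm tau) : conv tau t s -> conv tau s t
| conv_trans tau (t s u : tm tau) :
    conv tau t s -> conv tau s u -> conv tau t u
| conv_app rho tau (t t' : tm (rho ~> tau)) (s s' : tm rho) :
    conv (rho ~> tau) t t' -> conv rho s s' -> conv tau (App t s) (App t' s')
| conv_lam rho tau (t t' : tm tau) :
    conv tau t t' -> conv (rho ~> tau) (Lam rho t) (Lam rho t')
| conv_beta rho tau (t : tm tau) (s : tm rho) :
    conv tau (App (Lam rho t) s) (inst_tm t s)
| conv_split rho sigma tau (t : tm rho) (s : tm sigma)
    (f : tm (rho ~> sigma ~> tau)) :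
    conv tau (split_ (pair_ t s) f) (App (App f t) s)
| conv_cases_tt tau (t s : tm tau) : conv tau (cases_ tt_ t s) t
| conv_cases_ff tau (t s : tm tau) : conv tau (cases_ ff_ t s) s
| conv_recN_zero tau (a : tm tau) (f : tm (Nat ~> tau ~> tau)) :
    conv tau (recN zero a f) a
| conv_recN_succ tau (n : tm Nat) (a : tm tau) (f : tm (Nat ~> tau ~> tau)) :
    conv tau (recN (succ n) a f) (App (App f n) (recN n a f))
| conv_recL_nil rho tau (a : tm tau)
    (f : tm (rho ~> List rho ~> tau ~> tau)) :
    conv tau (recL (nil_ rho) a f) a
| conv_recL_cons rho tau (x : tm rho) (l : tm (List rho)) (a : tm tau)
    (f : tm (rho ~> List rho ~> tau ~> tau)) :
    conv tau (recL (cons_ x l) a f) (App (App (App f x) l) (recL l a f)).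

(** * Formulas *)

Inductive system : Type := MA | HA.

Definition is_MA (s : system) : Prop :=
  match s with MA => True | HA => False end.
Definition is_HA (s : system) : Prop :=
  match s with MA => False | HA => True end.

(** [form MA] and [form HA] are the formulas of the two systems: the guards make
    [Bot] available in [MA] only, and [Or] and [Ex] in [HA] only. *)
Inductive form (s : system) : Type :=
| At (t : tm Bool)
| Bot (h : is_MA s)
| Imp (A B : form s)
| And (A B : form s)
| Or (h : is_HA s) (A B : form s)
| All (tau : ty) (A : form s)
| Ex (h : is_HA s) (tau : ty) (A : form s).

Arguments At {s} t.
Arguments Bot {s} h.
Arguments Imp {s} A B.
Arguments And {s} A B.
Arguments Or {s} h A B.
Arguments All {s} tau A.
Arguments Ex {s} h tau A.

Infix "-->" := Imp (at level 60, right associativity).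

Definition Tru {s : system} : form s := At tt_.
Definition Fls {s : system} : form s := At ff_.
Definition bot : form MA := Bot (s := MA) I.

Fixpoint ren_form {s : system} (r : ren) (A : form s) : form s :=
  match A with
  | At t => At (ren_tm r t)
  | Bot h => Bot h
  | Imp A B => Imp (ren_form r A) (ren_form r B)
  | And A B => And (ren_form r A) (ren_form r B)
  | Or h A B => Or h (ren_form r A) (ren_form r B)
  | All tau A => All tau (ren_form (up_ren tau r) A)
  | Ex h tau A => Ex h tau (ren_form (up_ren tau r) A)
  end.

Fixpoint sub_form {s : system} (f : sub) (A : form s) : form s :=
  match A with
  | At t => At (sub_tm f t)
  | Bot h => Bot h
  | Imp A B => Imp (sub_form f A) (sub_form f B)
  | And A B => And (sub_form f A) (sub_form f B)
  | Or h A B => Or h (sub_form f A) (sub_form f B)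
  | All tau A => All tau (sub_form (up tau f) A)
  | Ex h tau A => Ex h tau (sub_form (up tau f) A)
  end.

Definition wk {s : system} (tau : ty) (A : form s) : form s :=
  ren_form (shift tau) A.

(** [inst A t] is [A(t)] outside the binder of the variable [Var tau 0] of [A]. *)
Definition inst {s : system} {tau : ty} (A : form s) (t : tm tau) : form s :=
  sub_form (scons t Var) A.

(** [repl A t] is [A(t)] under the binder of the variable [Var tau 0] of [A],
    which may occur in [t] again. *)
Definition repl {s : system} {tau : ty} (A : form s) (t : tm tau) : form s :=
  sub_form (scons t (fun sigma n => Var sigma (shift tau sigma n))) A.

(** An object variable, that is, the free variable [Var otype oindex]; [all_ x A]
    and [ex_ x A] bind its free occurrences in [A]. *)
Record ovar : Type := OVar { otype : ty; oindex : nat }.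

Definition close_ren (x : ovar) : ren :=
  fun tau n =>
    if ty_eq_dec (otype x) tau
    then if PeanoNat.Nat.eq_dec n (oindex x) then 0 else S n
    else n.

Definition all_ {s : system} (x : ovar) (A : form s) : form s :=
  All (otype x) (ren_form (close_ren x) A).

Definition ex_ (x : ovar) (A : form HA) : form HA :=
  Ex (s := HA) I (otype x) (ren_form (close_ren x) A).

(** [bot_sub A S] is [A^S], as a formula of the system [S] belongs to. *)
Fixpoint bot_sub {s : system} (A : form MA) (S : form s) : form s :=
  match A with
  | At t => At t
  | Bot _ => S
  | Imp A B => Imp (bot_sub A S) (bot_sub B S)
  | And A B => And (bot_sub A S) (bot_sub B S)
  | Or h _ _ => False_rect _ h
  | All tau A => All tau (bot_sub A (wk tau S))
  | Ex h _ _ => False_rect _ h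
  end.

Inductive conv_form {s : system} : form s -> form s -> Prop :=
| cf_at t t' : conv Bool t t' -> conv_form (At t) (At t')
| cf_bot h : conv_form (Bot h) (Bot h)
| cf_imp A A' B B' :
    conv_form A A' -> conv_form B B' -> conv_form (Imp A B) (Imp A' B')
| cf_and A A' B B' :
    conv_form A A' -> conv_form B B' -> conv_form (And A B) (And A' B')
| cf_or h A A' B B' :
    conv_form A A' -> conv_form B B' -> conv_form (Or h A B) (Or h A' B')
| cf_all tau A A' : conv_form A A' -> conv_form (All tau A) (All tau A')
| cf_ex h tau A A' : conv_form A A' -> conv_form (Ex h tau A) (Ex h tau A').

(** * Proofs *)

(** [prf G A]: there is a proof of [A] whose open assumptions are among [G].
    In [prf_allI], weakening [G] frees [Var tau 0] for use as the
    eigenvariable, which is thereby not free in [G].  In [prf_indL] the formula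
    [A] is moved under the additional binder of [x], whose type [rho] differs
    from [List rho], so that [x] is still [Var rho 0] under the binder of [l]. *)
Inductive prf {s : system} : list (form s) -> form s -> Prop :=
| prf_hyp G A : In A G -> prf G A
| prf_impI G A B : prf (A :: G) B -> prf G (A --> B)
| prf_impE G A B : prf G (A --> B) -> prf G A -> prf G B
| prf_andI G A B : prf G A -> prf G B -> prf G (And A B)
| prf_andE1 G A B : prf G (And A B) -> prf G A
| prf_andE2 G A B : prf G (And A B) -> prf G B
| prf_allI G tau A : prf (map (wk tau) G) A -> prf G (All tau A)
| prf_allE G tau A (t : tm tau) : prf G (All tau A) -> prf G (inst A t)
| prf_conv G A B : conv_form A B -> prf G A -> prf G B
| prf_true G : prf G Tru
| prf_indB G A : prf G (All Bool (repl A tt_ --> repl A ff_ --> A))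
| prf_indN G A :
    prf G (All Nat
      (repl A zero
       --> wk Nat (All Nat (A --> repl A (succ (Var Nat 0))))
       --> A))
| prf_indL G rho A :
    prf G (All (List rho)
      (repl A (nil_ rho)
       --> wk (List rho)
             (All rho (All (List rho)
               (let A' := ren_form (up_ren (List rho) (shift rho)) A in
                A' --> repl A' (cons_ (Var rho 0) (Var (List rho) 0)))))
       --> A))
| prf_botI G (h : is_MA s) : prf G (Fls --> Bot h)
| prf_orI1 G (h : is_HA s) A B : prf G (A --> Or h A B)
| prf_orI2 G (h : is_HA s) A B : prf G (B --> Or h A B)
| prf_orE G (h : is_HA s) A B C :
    prf G (Or h A B --> (A --> C) --> (B --> C) --> C)
| prf_exI G (h : is_HA s) tau A (t : tm tau) : prf G (inst A t --> Ex h tau A)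
| prf_exE G (h : is_HA s) tau A C :
    prf G (Ex h tau A --> All tau (A --> wk tau C) --> C).

Definition provable (s : system) (A : form s) : Prop := prf [] A.

(* Main.v *)
(** Since D follows from D^F and G entails ¬¬G^F (negation with respect to ⊥),
    the third hypothesis yields MA |- D^F -> ∀x(G^F -> ⊥) -> ⊥.  Replacing ⊥ by a
    formula S turns MA-proofs into HA-proofs, because HA proves F -> S for every
    S, and leaves D^F and G^F alone.  For S := ∃x G^F the premise
    ∀x(G^F -> S) is the introduction rule of ∃, which leaves D^F -> S. *)

Require Import Defs.
From Stdlib Require Import List.
Import ListNotations.

(** * Renaming and substitution *)

Lemma up_ren_ext rho (r r' : ren) :
  (forall tau n, r tau n = r' tau n) ->
  forall tau n, up_ren rho r tau n = up_ren rho r' tau n.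
Proof.
  intros H tau n; unfold up_ren.
  destruct (ty_eq_dec rho tau); [destruct n|]; rewrite ?H; reflexivity.
Qed.

Lemma ren_tm_ext tau (t : tm tau) : forall r r' : ren,
  (forall sigma n, r sigma n = r' sigma n) -> ren_tm r t = ren_tm r' t.
Proof.
  induction t as [|? ?|? ? t IHt u IHu|rho tau t IHt]; intros r r' H; cbn.
  - now rewrite H.
  - reflexivity.
  - now rewrite (IHt r r'), (IHu r r').
  - now rewrite (IHt _ _ (up_ren_ext rho r r' H)).
Qed.

Lemma ren_ren_tm tau (t : tm tau) : forall r r' : ren,
  ren_tm r (ren_tm r' t) = ren_tm (fun sigma n => r sigma (r' sigma n)) t.
Proof.
  induction t as [|? ?|? ? t IHt u IHu|rho tau t IHt]; intros r r'; cbn.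
  - reflexivity.
  - reflexivity.
  - now rewrite IHt, IHu.
  - rewrite IHt; f_equal; apply ren_tm_ext; intros sigma n; unfold up_ren.
    destruct (ty_eq_dec rho sigma); [destruct n|]; reflexivity.
Qed.

Lemma up_ren_shift rho (r : ren) sigma n :
  up_ren rho r sigma (shift rho sigma n) = shift rho sigma (r sigma n).
Proof.
  unfold up_ren, shift; now destruct (ty_eq_dec rho sigma).
Qed.

Lemma up_ext rho (f g : sub) :
  (forall tau n, f tau n = g tau n) ->
  forall tau n, up rho f tau n = up rho g tau n.
Proof.
  intros H tau n; unfold up, scons.
  destruct (ty_eq_dec rho tau); [destruct n|]; rewrite ?H; reflexivity.
Qed.

Lemma sub_tm_ext tau (t : tm tau) : forall f g : sub,
  (forall sigma n, f sigma n = g sigma n) -> sub_tm f t = sub_tm g t.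
Proof.
  induction t as [|? ?|? ? t IHt u IHu|rho tau t IHt]; intros f g H; cbn.
  - apply H.
  - reflexivity.
  - now rewrite (IHt f g), (IHu f g).
  - now rewrite (IHt _ _ (up_ext rho f g H)).
Qed.

Lemma up_up_ren rho (f : sub) (r : ren) tau n :
  up rho f tau (up_ren rho r tau n) =
  up rho (fun sigma m => f sigma (r sigma m)) tau n.
Proof.
  unfold up, scons, up_ren.
  destruct (ty_eq_dec rho tau); [destruct n|]; reflexivity.
Qed.

Lemma ren_up rho (f : sub) (r : ren) tau n :
  ren_tm (up_ren rho r) (up rho f tau n) =
  up rho (fun sigma m => ren_tm r (f sigma m)) tau n.
Proof.
  assert (E : forall m,
    ren_tm (up_ren rho r) (ren_tm (shift rho) (f tau m)) =
    ren_tm (shift rho) (ren_tm r (f tau m))).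
  { intros m; rewrite !ren_ren_tm; apply ren_tm_ext.
    intros; apply up_ren_shift. }
  unfold up, scons; destruct (ty_eq_dec rho tau) as [e|]; [|apply E].
  destruct n; [|apply E].
  destruct e; cbn; unfold up_ren.
  now destruct (ty_eq_dec rho rho).
Qed.

Lemma up_var rho (r : ren) tau n :
  up rho (fun sigma m => Var sigma (r sigma m)) tau n =
  Var tau (up_ren rho r tau n).
Proof.
  unfold up, scons, up_ren, shift; cbn.
  destruct (ty_eq_dec rho tau) as [e|]; [destruct e, n|]; reflexivity.
Qed.

Lemma sub_ren_tm tau (t : tm tau) : forall (f : sub) (r : ren),
  sub_tm f (ren_tm r t) = sub_tm (fun sigma n => f sigma (r sigma n)) t.
Proof.
  induction t as [|? ?|? ? t IHt u IHu|rho tau t IHt]; intros f r; cbn.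
  - reflexivity.
  - reflexivity.
  - now rewrite IHt, IHu.
  - rewrite IHt; f_equal; apply sub_tm_ext; intros; apply up_up_ren.
Qed.

Lemma ren_sub_tm tau (t : tm tau) : forall (f : sub) (r : ren),
  ren_tm r (sub_tm f t) = sub_tm (fun sigma n => ren_tm r (f sigma n)) t.
Proof.
  induction t as [|? ?|? ? t IHt u IHu|rho tau t IHt]; intros f r; cbn.
  - reflexivity.
  - reflexivity.
  - now rewrite IHt, IHu.
  - rewrite IHt; f_equal; apply sub_tm_ext; intros; apply ren_up.
Qed.

Lemma ren_tm_sub tau (t : tm tau) : forall r : ren,
  ren_tm r t = sub_tm (fun sigma n => Var sigma (r sigma n)) t.
Proof.
  induction t as [|? ?|? ? t IHt u IHu|rho tau t IHt]; intros r; cbn.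
  - reflexivity.
  - reflexivity.
  - now rewrite IHt, IHu.
  - rewrite IHt; f_equal; apply sub_tm_ext; intros; now rewrite up_var.
Qed.

Lemma sub_tm_var tau (t : tm tau) : sub_tm Var t = t.
Proof.
  induction t as [|? ?|? ? t IHt u IHu|rho tau t IHt]; cbn.
  - reflexivity.
  - reflexivity.
  - now rewrite IHt, IHu.
  - f_equal; rewrite <- IHt at 2; apply sub_tm_ext; intros sigma n.
    rewrite (up_var rho (fun _ m => m)); unfold up_ren.
    destruct (ty_eq_dec rho sigma); [destruct n|]; reflexivity.
Qed.

Lemma sub_form_ext s (A : form s) : forall f g : sub,
  (forall sigma n, f sigma n = g sigma n) -> sub_form f A = sub_form g A.
Proof.
  induction A; intros f g H; cbn; f_equal; auto using sub_tm_ext, up_ext.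
Qed.

Lemma sub_ren_form s (A : form s) : forall (f : sub) (r : ren),
  sub_form f (ren_form r A) = sub_form (fun sigma n => f sigma (r sigma n)) A.
Proof.
  induction A; intros f r; cbn; f_equal; auto using sub_ren_tm;
    rewrite IHA; apply sub_form_ext; intros; apply up_up_ren.
Qed.

Lemma ren_sub_form s (A : form s) : forall (f : sub) (r : ren),
  ren_form r (sub_form f A) = sub_form (fun sigma n => ren_tm r (f sigma n)) A.
Proof.
  induction A; intros f r; cbn; f_equal; auto using ren_sub_tm;
    rewrite IHA; apply sub_form_ext; intros; apply ren_up.
Qed.

(** Since a renaming is a substitution of variables, laws proved for substitution carry over to
    renaming, and in particular to [wk]. *)
Lemma ren_form_sub s (A : form s) : forall r : ren,
  ren_form r A = sub_form (fun sigma n => Var sigma (r sigma n)) A.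
Proof.
  induction A; intros r; cbn; f_equal; auto using ren_tm_sub;
    rewrite IHA; apply sub_form_ext; intros; now rewrite up_var.
Qed.

Lemma sub_form_var s (A : form s) : sub_form Var A = A.
Proof.
  assert (E : forall tau (B : form s), sub_form (up tau Var) B = sub_form Var B).
  { intros tau B; apply sub_form_ext; intros sigma n.
    rewrite (up_var tau (fun _ m => m)); unfold up_ren.
    destruct (ty_eq_dec tau sigma); [destruct n|]; reflexivity. }
  induction A; cbn; f_equal; auto using sub_tm_var; now rewrite E.
Qed.

Lemma sub_up_wk s tau (A : form s) (f : sub) :
  sub_form (up tau f) (wk tau A) = wk tau (sub_form f A).
Proof.
  unfold wk; rewrite sub_ren_form, ren_sub_form.
  apply sub_form_ext; intros sigma n; unfold up, scons, shift.
  now destruct (ty_eq_dec tau sigma).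
Qed.

Lemma sub_scons_wk s tau (t : tm tau) (f : sub) (A : form s) :
  sub_form (scons t f) (wk tau A) = sub_form f A.
Proof.
  unfold wk; rewrite sub_ren_form.
  apply sub_form_ext; intros sigma n; unfold scons, shift.
  now destruct (ty_eq_dec tau sigma).
Qed.

Lemma ren_up_wk s tau (A : form s) (r : ren) :
  ren_form (up_ren tau r) (wk tau A) = wk tau (ren_form r A).
Proof.
  rewrite (ren_form_sub s A r), <- sub_up_wk, ren_form_sub.
  apply sub_form_ext; intros; now rewrite up_var.
Qed.

(** The renamed formula is the body of [wk tau (All tau A)]. A quantified assumption that has been
    moved under a new binder can thus be specialised to the new variable, which gives back [A]. *)
Lemma inst_up_shift s tau (A : form s) :
  inst (ren_form (up_ren tau (shift tau)) A) (Var tau 0) = A.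
Proof.
  unfold inst; rewrite sub_ren_form; rewrite <- (sub_form_var s A) at 2.
  apply sub_form_ext; intros sigma n; unfold scons, up_ren, shift.
  destruct (ty_eq_dec tau sigma) as [e|]; [destruct e, n|]; reflexivity.
Qed.

(** * Replacing ⊥ *)

(** [S] is substituted along with [A]. It varies in the induction because each quantifier weakens
    it; [sub_up_wk] handles that case. *)
Lemma bot_sub_sub s (A : form MA) : forall (f : sub) (S : form s),
  bot_sub (sub_form f A) (sub_form f S) = sub_form f (bot_sub A S).
Proof.
  induction A; intros f S; cbn; try contradiction; f_equal; auto.
  now rewrite <- sub_up_wk.
Qed.

Lemma bot_sub_ren s (A : form MA) (r : ren) (S : form s) :
  bot_sub (ren_form r A) (ren_form r S) = ren_form r (bot_sub A S).
Proof.
  rewrite !ren_form_sub; apply bot_sub_sub.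
Qed.

Lemma bot_sub_wk s tau (A : form MA) (S : form s) :
  bot_sub (wk tau A) (wk tau S) = wk tau (bot_sub A S).
Proof.
  apply bot_sub_ren.
Qed.

(** Instantiating the bound variable cancels the weakening of [S], so [S] itself is unaffected by
    [t]. *)
Lemma bot_sub_inst s tau (A : form MA) (t : tm tau) (S : form s) :
  bot_sub (inst A t) S = inst (bot_sub A (wk tau S)) t.
Proof.
  unfold inst; rewrite <- bot_sub_sub, sub_scons_wk.
  now rewrite sub_form_var.
Qed.

Lemma bot_sub_repl s tau (A : form MA) (t : tm tau) (S : form s) :
  bot_sub (repl A t) (wk tau S) = repl (bot_sub A (wk tau S)) t.
Proof.
  unfold repl; rewrite <- bot_sub_sub, sub_scons_wk.
  now rewrite <- ren_form_sub.
Qed.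

Lemma bot_sub_Fls_idem s (A : form MA) : forall S : form s,
  bot_sub (bot_sub A (Fls (s := MA))) S = bot_sub A Fls.
Proof.
  induction A; intros S; cbn; try contradiction; f_equal; auto.
Qed.

Lemma bot_sub_all_imp_bot s (x : ovar) (A : form MA) (S : form s) :
  bot_sub (all_ x (bot_sub A Fls --> bot)) S =
  All (otype x) (ren_form (close_ren x) (bot_sub A Fls) --> wk (otype x) S).
Proof.
  unfold all_; cbn; do 2 f_equal.
  (* [Fls] is closed, hence its own renaming: closing over [x] can be moved inside the
     replacement. *)
  rewrite <- (bot_sub_ren MA A _ Fls), <- (bot_sub_ren s A _ Fls).
  apply bot_sub_Fls_idem.
Qed.

Lemma conv_form_refl s (A : form s) : conv_form A A.
Proof.
  induction A; constructor; auto; apply conv_refl.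
Qed.

Lemma bot_sub_conv s (A B : form MA) :
  conv_form A B -> forall S : form s, conv_form (bot_sub A S) (bot_sub B S).
Proof.
  induction 1; intros S; cbn; try contradiction;
    try constructor; auto using conv_form_refl.
Qed.

(** * Translation of [MA]-proofs into [HA]-proofs *)

Ltac hyp := apply prf_hyp; cbn; tauto.

Lemma ex_falso (A : form HA) : forall G, prf G (Fls --> A).
Proof.
  induction A as [t|h|A IHA B IHB|A IHA B IHB|h A IHA B IHB|tau A IHA|h tau A IHA];
    intros G; try contradiction.
  (* Boolean case distinction on [t]: at [tt_] the conclusion is the axiom [Tru], at [ff_] it is the
     assumption [Fls]. *)
  - pose proof (prf_allE _ _ _ t (prf_indB G (Fls --> At (Var Bool 0)))) as H.
    refine (prf_impE _ _ _ (prf_impE _ _ _ H _) _); apply prf_impI.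
    + apply prf_true.
    + hyp.
  - do 2 apply prf_impI; apply prf_impE with Fls; [apply IHB | hyp].
  - apply prf_impI, prf_andI; apply prf_impE with Fls; auto; hyp.
  - apply prf_impI, prf_impE with A; [apply prf_orI1|].
    apply prf_impE with Fls; [apply IHA | hyp].
  - apply prf_impI, prf_allI, prf_impE with Fls; [apply IHA | hyp].
  (* Every type contains variables, so [Var tau 0] serves as witness. The induction hypothesis is
     generalised and then specialised to it. *)
  - apply prf_impI, prf_impE with (inst A (Var tau 0)); [apply prf_exI|].
    apply prf_impE with Fls; [|hyp].
    exact (prf_allE _ tau (Fls --> A) (Var tau 0) (prf_allI _ _ _ (IHA _))).
Qed.

(** Rules and common axioms turn into instances of themselves; only the axiom for ⊥ becomes
    [Fls --> S], which is [ex_falso]. Quantifying over [S] inside the induction allows [wk tau S]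
    under an eigenvariable. *)
Lemma prf_bot_sub (G : list (form MA)) (A : form MA) :
  prf G A ->
  forall S : form HA, prf (map (fun B => bot_sub B S) G) (bot_sub A S).
Proof.
  induction 1 as [G A HA|G A B _ IH|G A B _ IH1 _ IH2|G A B _ IH1 _ IH2
    |G A B _ IH|G A B _ IH|G tau A _ IH|G tau A t _ IH|G A B HAB _ IH
    |G|G A|G A|G rho A|G h|G []|G []|G []|G []|G []]; intros S; cbn.
  - apply prf_hyp; exact (in_map (fun B => bot_sub B S) _ _ HA).
  - apply prf_impI, IH.
  - exact (prf_impE _ _ _ (IH1 S) (IH2 S)).
  - apply prf_andI; auto.
  - exact (prf_andE1 _ _ _ (IH S)).
  - exact (prf_andE2 _ _ _ (IH S)).
  - apply prf_allI; specialize (IH (wk tau S)).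
    rewrite map_map in *; erewrite map_ext; [exact IH|].
    intros B; cbn; now rewrite bot_sub_wk.
  - rewrite bot_sub_inst; apply prf_allE, IH.
  - exact (prf_conv _ _ _ (bot_sub_conv HA _ _ HAB S) (IH S)).
  - apply prf_true.
  - rewrite !bot_sub_repl; apply prf_indB.
  (* The induction step is a weakened formula, so the replacement has to be moved past [wk] before
     the axiom for the translated formula applies. *)
  - pose proof (bot_sub_wk HA Nat (All Nat (A --> repl A (succ (Var Nat 0)))) S)
      as E.
    cbn in E; rewrite bot_sub_repl in E; rewrite bot_sub_repl.
    rewrite E; apply prf_indN.
  - set (A' := ren_form (up_ren (List rho) (shift rho)) A).
    pose proof (bot_sub_wk HA (List rho)
      (All rho (All (List rho)
        (A' --> repl A' (cons_ (Var rho 0) (Var (List rho) 0))))) S) as E.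
    cbn in E; rewrite bot_sub_repl in E; rewrite bot_sub_repl.
    (* Below the binders of [x] and [l], [S] is weakened twice; [ren_up_wk] shows that this matches
       moving the translated [A] under the binder of [x]. *)
    assert (E' : bot_sub A' (wk (List rho) (wk rho S)) =
      ren_form (up_ren (List rho) (shift rho)) (bot_sub A (wk (List rho) S))).
    { rewrite <- bot_sub_ren, ren_up_wk; reflexivity. }
    rewrite E' in E; rewrite E; apply prf_indL.
  - apply ex_falso.
Qed.

(** * Quantifier steps and the final extraction *)

(** The premise is used as an assumption rather than as a theorem: it is then
    weakened along with the context by the introduction of the quantifier. *)
Lemma all_contra (x : ovar) (A B : form MA) :
  provable MA (all_ x (A --> (B --> bot) --> bot)) ->
  provable MA (all_ x (B --> bot) --> all_ x (A --> bot)).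
Proof.
  intros H; refine (prf_impE _ _ _ _ H); unfold all_; cbn.
  set (A' := ren_form (close_ren x) A); set (B' := ren_form (close_ren x) B).
  set (tau := otype x).
  apply prf_impI, prf_impI, prf_allI, prf_impI; cbn.
  set (Gam := A' :: _).
  assert (H1 : prf Gam (inst (ren_form (up_ren tau (shift tau))
    (A' --> (B' --> bot) --> bot)) (Var tau 0))) by (apply prf_allE; hyp).
  assert (H2 : prf Gam (inst (ren_form (up_ren tau (shift tau))
    (B' --> bot)) (Var tau 0))) by (apply prf_allE; hyp).
  rewrite inst_up_shift in H1, H2.
  apply (fun H => prf_impE _ _ _ (prf_impE _ _ _ H1 H) H2); hyp.
Qed.

(** Existential introduction with the bound variable itself as witness. *)
Lemma all_imp_ex tau (A : form HA) :
  provable HA (All tau (A --> wk tau (Ex (s := HA) I tau A))).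
Proof.
  apply prf_allI; rewrite <- (inst_up_shift HA tau A) at 1; apply prf_exI.
Qed.

Theorem theorem4p1 (D G : form MA) (x : ovar)
    (hD : provable MA (bot_sub D Fls --> D))
    (hG : provable MA (all_ x (G --> (bot_sub G Fls --> bot) --> bot)))
    (h : provable MA (D --> all_ x (G --> bot) --> bot)) :
  provable HA (bot_sub D Fls --> ex_ x (bot_sub G Fls)).
Proof.
  assert (K : provable MA
    (bot_sub D Fls --> all_ x (bot_sub G Fls --> bot) --> bot)).
  (* The three closed theorems enter by cut, which leaves a purely propositional implication. *)
  { refine (prf_impE _ _ _ (prf_impE _ _ _ (prf_impE _ _ _ _ hD) h)
      (all_contra _ _ _ hG)).
    do 5 apply prf_impI.
    apply prf_impE with (all_ x (G --> bot)).
    - apply prf_impE with D; [hyp|].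
      apply prf_impE with (bot_sub D Fls); hyp.
    - apply prf_impE with (all_ x (bot_sub G Fls --> bot)); hyp. }
  set (S := ex_ x (bot_sub G Fls)).
  apply prf_bot_sub with (S := S) in K.
  (* The replacement computes through implications and turns ⊥ into [S]; [all_] stays folded for the
     rewriting that follows. *)
  change (prf [] (bot_sub (bot_sub D Fls) S -->
    bot_sub (all_ x (bot_sub G Fls --> bot)) S --> S)) in K.
  rewrite bot_sub_Fls_idem, bot_sub_all_imp_bot in K.
  refine (prf_impE _ _ _ (prf_impE _ _ _ _ K) (all_imp_ex _ _)).
  do 3 apply prf_impI.
  eapply prf_impE; [eapply prf_impE|]; hyp.
Qed.
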